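(* Let $p\geq 5$ be a prime and let $m\geq 2$ be an integer with $p\nmid m$. Then $$ \begin{aligned} &(-1)^{\frac{p-1}{2}\lfloor m/2\rfloor}\left(\frac{m}{p}\right)\left(\frac{2}{p}\right)^{m-1}q^{2m\sum_{k=1}^{\lfloor m/2\rfloor}\binom{\lfloor kp/m\rfloor+1}{2}}\prod_{k=1}^{\lfloor m/2\rfloor}\begin{bmatrix}p-1\\ \lfloor kp/m\rfloor\end{bmatrix}_{q^{2m}}\\ \equiv\;&1+m[p]_q\,\mathrm{EQ}_p^*(m,q)+(2\lfloor m/2\rfloor+1)[p]_{q^m}\mathrm{Q}_p(2,q^m)-m[p]_q\mathrm{Q}_p(2,q)\\ &+m\left(|R_p(m)|+2\sum_{j=1}^{(p-1)/2}\left\lfloor\frac{jm}{p}\right\rfloor\right)(1-q^p)\pmod{[p]_q^2}, \end{aligned} $$ where $$ \mathrm{EQ}_p^*(m,q)=\left(\frac{m}{p}\right)\frac{(1+q^p)\,\mathrm{EQ}_p(m,q^2)}{1+q}=\frac{\left(\frac{m}{p}\right)q^{2\sum_{j\in R_p(m)}(p-\langle jm\rangle_p)}\,(q^{2m};q^{2m})_{\frac{p-1}{2}}\big/(q^2;q^2)_{\frac{p-1}{2}}-1}{[p]_{q}}. $$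
   Context: Here $q$ is an indeterminate. Notation: $\lfloor x\rfloor$ is the greatest integer not exceeding $x$; $\left(\frac{\cdot}{p}\right)$ is the Legendre symbol; $\langle x\rangle_p$ is the least non-negative residue of the integer $x$ modulo $p$; for a set $A$, $|A|$ is its cardinality. For a non-negative integer $n$, $[n]_q=\frac{1-q^n}{1-q}=1+q+\cdots+q^{n-1}$, and $(x;q)_n=(1-x)(1-xq)\cdots(1-xq^{n-1})$ if $n\ge 1$, $(x;q)_0=1$. The $q$-binomial coefficients are $$\begin{bmatrix}n\\k\end{bmatrix}_q=\frac{(1-q^n)(1-q^{n-1})\cdots(1-q^{n-k+1})}{(1-q^k)(1-q^{k-1})\cdots(1-q)}.$$ A subscript or argument $q^a$ in place of $q$ means that $q$ is replaced by $q^a$ throughout the definition. For an odd prime $p$ and an integer $m\ge 2$ prime to $p$, the $q$-Fermat quotient is $$\mathrm{Q}_p(m,q)=\frac{(q^m;q^m)_{p-1}/(q;q)_{p-1}-1}{[p]_q}.$$ Put $R_p(m)=\{1\le j<p/2:\ \langle jm\rangle_p>p/2\}$ ($j$ an integer). The $q$-Euler quotient is $$\mathrm{EQ}_p(m,q)=\frac{q^{\sum_{j\in R_p(m)}(p-\langle jm\rangle_p)}\,(q^m;q^m)_{\frac{p-1}{2}}\big/(q;q)_{\frac{p-1}{2}}-\left(\frac{m}{p}\right)}{[p]_q}.$$ Congruences are understood for rational functions in $q$ over $\mathbb{Q}$ (with denominators prime to the modulus): $A\equiv B\pmod{[p]_q^k}$ means that $A-B=[p]_q^k\,F/G$ with $F,G\in\mathbb{Q}[q]$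 and $G$ relatively prime to $[p]_q$. *)

(* Defs.v *)
From mathcomp Require Import all_boot all_order all_algebra.

Set Implicit Arguments.
Unset Strict Implicit.
Unset Printing Implicit Defensive.

Import Order.TTheory GRing.Theory Num.Theory.
Local Open Scope ring_scope.

(* The q-analogues below take the base [x] as an argument, so that replacing
   q by q^a is evaluation at [qvar ^+ a]. *)

Definition ratfun : fieldType := {fraction {poly rat}}.

Definition qvar : ratfun := tofrac ('X : {poly rat}).

(* Over a plain ring, so that [p]_q is available both in {poly rat} and in
   ratfun. *)
Definition qint (A : nzRingType) (x : A) (n : nat) : A :=
  \sum_(0 <= i < n) x ^+ i.

Definition qpoch (A : nzRingType) (a x : A) (n : nat) : A :=
  \prod_(0 <= i < n) (1 - a * x ^+ i).

(* For k > n the truncated n - i vanishes at i = n, so the value is 0. *)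
Definition qbinom (K : fieldType) (x : K) (n k : nat) : K :=
  (\prod_(0 <= i < k) (1 - x ^+ (n - i)))
    / (\prod_(0 <= i < k) (1 - x ^+ (k - i))).

Definition legendre (m p : nat) : int :=
  if (p %| m)%N then 0
  else if [exists x : 'I_p, (x ^ 2 == m %[mod p])%N] then 1 else -1.

Definition qFermat (K : fieldType) (p m : nat) (x : K) : K :=
  (qpoch (x ^+ m) (x ^+ m) p.-1 / qpoch x x p.-1 - 1) / qint x p.

(* The comparisons with p / 2 are doubled to stay in nat. *)
Definition Rset (p m : nat) : {set 'I_p} :=
  [set j : 'I_p | [&& (1 <= j)%N, (2 * j < p)%N & (p < 2 * ((j * m) %% p))%N]].

Definition Rsum (p m : nat) : nat :=
  (\sum_(j in Rset p m) (p - (j * m) %% p))%N.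

Definition qEuler (K : fieldType) (p m : nat) (x : K) : K :=
  (x ^+ Rsum p m * (qpoch (x ^+ m) (x ^+ m) (p.-1 %/ 2) / qpoch x x (p.-1 %/ 2))
     - (legendre m p)%:~R) / qint x p.

Definition qEulerStar (K : fieldType) (p m : nat) (x : K) : K :=
  (legendre m p)%:~R * ((1 + x ^+ p) * qEuler p m (x ^+ 2) / (1 + x)).

(* A = B modulo M ^ k; for nonconstant M coprimality already forces G != 0. *)
Definition ratfun_eqmod (A B : ratfun) (M : {poly rat}) (k : nat) : Prop :=
  exists F G : {poly rat},
    coprimep G M /\ A - B = tofrac M ^+ k * (tofrac F / tofrac G).

(* Main.v *)
Require Import Defs.
From mathcomp Require Import all_boot all_order all_algebra.
From mathcomp Require Import finfield zify ring.

Set Implicit Arguments.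
Unset Strict Implicit.
Unset Printing Implicit Defensive.

Import Order.TTheory GRing.Theory Num.Theory.
Local Open Scope ring_scope.

(** Put h = (p-1)/2 and t = 1 - q^p = (1-q)[p]_q, so that t^2 vanishes modulo
    [p]_q^2. The three nontrivial products in the statement are all congruent to
    1 modulo [p]_q, hence of the form 1 + t a modulo [p]_q^2 with a determined
    modulo [p]_q. Such first-order expansions multiply by adding the coefficients
    a (predicate [expands]), so the congruence modulo [p]_q^2 reduces to a linear
    identity modulo [p]_q between sums of the quantities G(n) = 1/(1-q^(2n)).

    Write jm = p f_j + r_j with 0 <= r_j < p, let rho_j be 1 if r_j > p/2 and 0
    otherwise, and let g_j be r_j or p - r_j, whichever is below p/2. All
    coefficients come from the two ratios (1 - u y)/(1 - y) and (u - y)/(1 - y),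
    where u is a power of q^p.
    - The q-binomial product has coefficient -2m sum_k sum_(i <= kp/m) G(mi). For
      fixed i <= h, the k <= m/2 with i <= kp/m are those above f_i, so it equals
      -2m sum_i (floor(m/2) - f_i) G(mi); this is [expands_qbinom_product].
    - The product in the q-Euler quotient is regrouped by the permutation
      j -> g_j of 1..h; Gauss's lemma turns the Legendre symbol into the product of
      the signs (-1)^rho_j, and the coefficient is
      sum_j 2 (f_j + rho_j)(G(mj) - 1); this is [expands_euler].
    - The product (y^2;y^2)_(p-1) / (y;y)_(p-1) with y = q^a, which defines the q-Fermat
      quotient for 2, has coefficient -a sum_i G(ai); this is
      [expands_qpoch_double].

    The three coefficients involve only the G(mi), except for sum_i G(i), which
    comes from y = q. The permutation i -> g_i and the relation
    G(n) + G(p-n) = 1 modulo [p]_q rewrite it as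
    sum_i (rho_i (1 - 2 G(mi)) + G(mi)), see [sum_inv_absres], and the
    identity then holds term by term in i ([expansions_balance]).

    The sign in front of the q-binomial product is cancelled by the signs
    (-1)^floor(kp/m) of the q-binomial coefficients ([sign_product]). This is an
    Eisenstein-type parity count: jm = p f_j + r_j summed over j <= h, read modulo 2
    and combined with Gauss's lemma, gives (m/p)(2/p)^(m-1) = (-1)^(sum_j f_j),
    while the lattice points below the line of slope p/m count
    sum_k floor(kp/m) = h floor(m/2) - sum_j f_j. *)

(** * Least absolute residues and Gauss's lemma *)

Definition halfp (p : nat) : nat := (p.-1 %/ 2)%N.

Lemma halfpK (p : nat) : odd p -> p = ((halfp p).*2).+1.
Proof.
rewrite /halfp divn2 => p_odd.
by case: p p_odd => // n /= /negPf n_even; rewrite -[in LHS](odd_double_half n) n_even.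
Qed.

Lemma prime_ge5_odd (p : nat) : prime p -> (5 <= p)%N -> odd p.
Proof. by move=> /even_prime[->|]. Qed.

Definition far (p m j : nat) : bool := (p < 2 * ((j * m) %% p))%N.

(** The residue of jm modulo p of least absolute value is -(absres p m j) when
    [far p m j] holds and absres p m j otherwise. *)
Definition absres (p m j : nat) : nat :=
  if far p m j then (p - (j * m) %% p)%N else ((j * m) %% p)%N.

Lemma ndvd_low (p j : nat) :
  odd p -> (1 <= j < (halfp p).+1)%N -> ~~ (p %| j)%N.
Proof. by move=> /halfpK Dp Hj; rewrite gtnNdvd //; lia. Qed.

Section AbsoluteResidues.

Variables p m : nat.
Hypotheses (p_pr : prime p) (p_odd : odd p) (ndvd : ~~ (p %| m)%N).

Let Dp := halfpK p_odd.

Lemma ndvd_mul j : ~~ (p %| j)%N -> ~~ (p %| j * m)%N.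
Proof. by move=> pj; rewrite Euclid_dvdM // negb_or pj. Qed.

Lemma absres_low j : (1 <= j < (halfp p).+1)%N ->
  (1 <= absres p m j < (halfp p).+1)%N.
Proof.
move=> /(ndvd_low p_odd) /ndvd_mul; rewrite /dvdn /absres /far => r_neq0.
have := ltn_pmod (j * m) (prime_gt0 p_pr).
by case: ifP => Hr Hp; lia.
Qed.

Lemma absres_mod j :
  (if far p m j then p %| j * m + absres p m j else j * m == absres p m j %[mod p])%N.
Proof.
rewrite /absres; case: (far p m j); last by rewrite modn_mod.
have lt_p := ltn_pmod (j * m) (prime_gt0 p_pr).
rewrite {1}(divn_eq (j * m) p) -addnA subnKC; last exact: ltnW.
by rewrite dvdn_addr // dvdn_mull.
Qed.

(** Equal least absolute residues mean im = jm or im = -jm modulo p, and i + j < p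
    for i, j < p/2 excludes the second. *)
Lemma absres_inj : {in [pred j | 1 <= j < (halfp p).+1]%N &, injective (absres p m)}.
Proof.
move=> i j; rewrite !inE.
wlog le_ij : i j / (i <= j)%N.
  move=> W Hi Hj e; case/orP: (leq_total i j) => le; first exact: W.
  by symmetry; apply: W.
move=> Hi Hj e.
have dvd_sum : (p %| (i + j) * m)%N -> i = j.
  by rewrite Euclid_dvdM // (negPf ndvd) orbF gtnNdvd //; lia.
have dvd_dif : (p %| (j - i) * m)%N -> i = j.
  rewrite Euclid_dvdM // (negPf ndvd) orbF => H.
  case: (ltnP i j) => lt; last by lia.
  by move: H; rewrite gtnNdvd //; lia.
have := absres_mod i; have := absres_mod j; rewrite -e.
case: ifP => _; case: ifP => _.
- move=> Hj' Hi'; apply: dvd_dif; rewrite mulnBl.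
  by rewrite -(subnDr (absres p m i)) dvdn_sub.
- move=> Hj' /eqP Hi'; apply: dvd_sum; rewrite mulnDl addnC.
  by rewrite /dvdn -modnDmr Hi' modnDmr.
- move=> /eqP Hj' Hi'; apply: dvd_sum; rewrite mulnDl.
  by rewrite /dvdn -modnDmr Hj' modnDmr.
- move=> Hj' Hi'; apply: dvd_dif; rewrite mulnBl -eqn_mod_dvd; last by rewrite leq_mul2r le_ij orbT.
  by rewrite (eqP Hj') (eqP Hi').
Qed.

Lemma absres_perm :
  perm_eq [seq absres p m j | j <- index_iota 1 (halfp p).+1]
          (index_iota 1 (halfp p).+1).
Proof.
have Uf : uniq [seq absres p m j | j <- index_iota 1 (halfp p).+1].
  rewrite map_inj_in_uniq ?iota_uniq // => i j; rewrite !mem_index_iota.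
  exact: absres_inj.
have Sf : {subset [seq absres p m j | j <- index_iota 1 (halfp p).+1]
             <= index_iota 1 (halfp p).+1}.
  move=> _ /mapP[j Hj ->]; move: Hj; rewrite !mem_index_iota; exact: absres_low.
have [|_ eq_mem] := uniq_min_size Uf Sf; first by rewrite size_map.
by apply: uniq_perm => //; apply: iota_uniq.
Qed.

Lemma big_absres (R : Type) (x0 : R) (op : Monoid.com_law x0) (F : nat -> R) :
  \big[op/x0]_(1 <= j < (halfp p).+1) F (absres p m j)
    = \big[op/x0]_(1 <= j < (halfp p).+1) F j.
Proof. by rewrite -[RHS](perm_big _ absres_perm) big_map. Qed.

End AbsoluteResidues.

Section Gauss.

Variable p : nat.
Hypotheses (p_pr : prime p) (p_odd : odd p).

Let Dp := halfpK p_odd.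

Lemma natFp_eq (a b : nat) : (a%:R == b%:R :> 'F_p) = (a == b %[mod p])%N.
Proof. by rewrite -val_eqE /= !val_Fp_nat. Qed.

Lemma natFp_eq0 (a : nat) : (a%:R == 0 :> 'F_p) = (p %| a)%N.
Proof. by rewrite (natFp_eq a 0) mod0n. Qed.

Lemma fermat_Fp (x : 'F_p) : x != 0 -> x ^+ p.-1 = 1.
Proof.
move=> x0; apply: (mulfI x0); rewrite -exprS prednK ?prime_gt0 // mulr1.
by have := expf_card x; rewrite card_Fp.
Qed.

Lemma low_squares_uniq :
  uniq [seq (j%:R : 'F_p) ^+ 2 | j <- index_iota 1 (halfp p).+1].
Proof.
rewrite map_inj_in_uniq ?iota_uniq // => i j; rewrite !mem_index_iota => Hi Hj /eqP.
rewrite eqf_sqr => /orP[]; first by rewrite natFp_eq !modn_small => [/eqP||]; lia.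
rewrite -addr_eq0 -natrD natFp_eq0 gtnNdvd //; lia.
Qed.

(** The squares of 1..h are h distinct roots of X^h - 1, so a non-residue m cannot be
    another one, and m^h is the other square root of 1. *)
Lemma euler_criterion (m : nat) : ~~ (p %| m)%N ->
  (legendre m p)%:~R = m%:R ^+ halfp p :> 'F_p.
Proof.
move=> ndvd; rewrite /legendre (negPf ndvd).
have m0 : (m%:R : 'F_p) != 0 by rewrite natFp_eq0.
case: ifP => [/existsP[x Hx]|/negbT/existsPn nsq].
  have /eqP Em : (x%:R : 'F_p) ^+ 2 == m%:R by rewrite -natrX natFp_eq.
  have x0 : (x%:R : 'F_p) != 0 by move: m0; rewrite -Em expf_eq0.
  (* 2h is read as (2h+1).-1 in order to fold p.-1. *)
  by rewrite -Em -exprM mul2n -[_.*2]/(_.+1.-1) -Dp fermat_Fp.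
have /eqP : (m%:R ^+ halfp p : 'F_p) ^+ 2 = 1 ^+ 2.
  by rewrite -exprM muln2 -[_.*2]/(_.+1.-1) -Dp fermat_Fp // expr1n.
rewrite eqf_sqr => /orP[/eqP m1|/eqP ->]; last by [].
have h0 : (0 < halfp p)%N by move: (prime_gt1 p_pr); lia.
(* One root too many: m together with all the nonzero squares. *)
pose rs := (m%:R : 'F_p) :: [seq (j%:R : 'F_p) ^+ 2 | j <- index_iota 1 (halfp p).+1].
have := @max_poly_roots _ ('X^(halfp p) - 1 : {poly 'F_p}) rs.
rewrite -size_poly_eq0 size_XnsubC // => /(_ isT); rewrite /= size_map size_iota subn1 ltnn.
move=> H; exfalso; suff: false by []; apply: H; last first.
  rewrite /= low_squares_uniq andbT; apply/mapP => -[j _ Ej].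
  have lt_p : (j %% p < p)%N by rewrite ltn_pmod ?prime_gt0.
  have := nsq (Ordinal lt_p); rewrite /= modnXm -natFp_eq natrX Ej eqxx //.
rewrite /= {1}/root !hornerE m1 subrr eqxx /=.
apply/allP => _ /mapP[j Hj ->]; rewrite mem_index_iota in Hj.
rewrite /root !hornerE -exprM mul2n -[_.*2]/(_.+1.-1) -Dp fermat_Fp ?subrr //.
by rewrite natFp_eq0 gtnNdvd //; lia.
Qed.

(** The product of the jm over j = 1..h is m^h h!; reducing each factor to its least
    absolute residue, it is also h! times one sign for each far j. *)
Lemma gauss_lemma (m : nat) : ~~ (p %| m)%N ->
  legendre m p = (-1) ^+ (\sum_(1 <= j < (halfp p).+1) far p m j).
Proof.
move=> ndvd.
have FpE : ((legendre m p)%:~R : 'F_p) = (-1) ^+ (\sum_(1 <= j < (halfp p).+1) far p m j).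
  have fact0 : \prod_(1 <= j < (halfp p).+1) (j%:R : 'F_p) != 0.
    rewrite prodf_seq_neq0; apply/allP => j; rewrite mem_index_iota /= => Hj.
    by rewrite natFp_eq0 (ndvd_low p_odd).
  apply: (mulIf fact0); rewrite euler_criterion //.
  transitivity (\prod_(1 <= j < (halfp p).+1) ((j * m)%:R : 'F_p)).
    under [RHS]eq_bigr do rewrite natrM mulrC.
    by rewrite big_split /= prodr_const_nat subn1.
  rewrite -[X in _ = _ * X](big_absres p_pr p_odd ndvd) -prodrXr -big_split /=.
  apply: eq_bigr => j _; have := absres_mod m p_pr j.
  case: (far p m j) => H; apply/eqP.
    by rewrite expr1 mulN1r -addr_eq0 -natrD natFp_eq0.
  by rewrite expr0 mul1r natFp_eq.
(* Two signs that agree in F_p are equal, because 1 != -1 there. *)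
move: FpE; set n := (\sum_(_ <= _ < _) _)%N.
rewrite -(signr_odd 'F_p n) -(signr_odd int n).
set b := odd _; have -> : legendre m p = (-1) ^+ (legendre m p == -1).
  by rewrite /legendre (negPf ndvd); case: ifP.
rewrite rmorph_sign; have N1 : (1 : 'F_p) != -1.
  rewrite -addr_eq0 -[1 + 1]/(2%:R) natFp_eq0 gtnNdvd //; lia.
case: (legendre m p == -1) b => [] [] //= /eqP; rewrite !(expr0, expr1).
  by rewrite eq_sym (negPf N1).
by rewrite (negPf N1).
Qed.

End Gauss.

(** * Lattice points and the sign *)

Lemma floor_low (p m i : nat) : odd p -> (i < (halfp p).+1)%N ->
  ((i * m) %/ p <= m %/ 2)%N.
Proof.
move=> /halfpK Dp Hi; rewrite leq_divRL //.
have := leq_divM (i * m) p; set f := (_ %/ p)%N => le_f.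
case: (leqP (f * 2) m) => // lt_m; have le2 : (i * 2 <= p)%N by lia.
have : (f * 2 * p <= m * p)%N.
  rewrite mulnAC; apply: leq_trans (_ : i * m * 2 <= _)%N; first by rewrite leq_mul2r le_f orbT.
  by rewrite mulnAC mulnC leq_mul2l le2 orbT.
by rewrite leq_mul2r leqNgt lt_m orbF Dp.
Qed.

(** Both sides sum F i over the lattice points (k, i) with 1 <= k <= m/2 and
    1 <= i <= kp/m, by columns and by rows. No such point lies on the line im = kp,
    and kp/m <= p/2 bounds i by h. *)
Lemma sum_floor_swap (V : nmodType) (p m : nat) (F : nat -> V) :
  odd p -> coprime p m -> (0 < m)%N ->
  \sum_(1 <= k < (m %/ 2).+1) \sum_(1 <= i < ((k * p) %/ m).+1) F i
    = \sum_(1 <= i < (halfp p).+1) F i *+ (m %/ 2 - (i * m) %/ p).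
Proof.
move=> p_odd cop m0; have Dp := halfpK p_odd.
have p0 : (0 < p)%N by rewrite Dp.
transitivity (\sum_(1 <= k < (m %/ 2).+1)
    \sum_(1 <= i < (halfp p).+1) (if (i <= (k * p) %/ m)%N then F i else 0)).
  rewrite big_nat [RHS]big_nat; apply: eq_bigr => k /andP[_ Hk].
  rewrite -big_mkcond /= [LHS](big_nat_widen _ _ (halfp p).+1) //.
  rewrite ltnS -ltnS ltn_divLR //.
  have le_k2 : (k * 2 * p <= m * p)%N by rewrite leq_mul2r -leq_divRL // -ltnS Hk orbT.
  have : (m * p = m * (halfp p).*2.+1)%N by rewrite -Dp.
  by lia.
rewrite exchange_big_nat /= big_nat [RHS]big_nat; apply: eq_bigr => i /andP[i1 Hi].
have lowi : (1 <= i < (halfp p).+1)%N by rewrite i1.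
have floor_le k : (i <= (k * p) %/ m)%N = ((i * m) %/ p < k)%N.
  (* The boundary case im = kp would make p divide i. *)
  rewrite leq_divRL // ltn_divLR // leq_eqVlt orbC orb_idr // => /eqP E.
  have : (p %| i * m)%N by rewrite E dvdn_mull.
  by rewrite Gauss_dvdl // (negPf (ndvd_low p_odd lowi)).
under eq_bigr do rewrite floor_le.
rewrite -big_mkcond /=.
transitivity (\sum_(((i * m) %/ p).+1 <= k < (m %/ 2).+1) F i).
  by rewrite [RHS](big_nat_widenl _ 1).
by rewrite sumr_const_nat subSS.
Qed.

(** Modulo 2, summing jm = p f_j + r_j over j with p odd gives
    m S = sum_j f_j + #far + S, where S = 1 + ... + h is also the sum of the least
    absolute residues. Gauss's lemma turns #far into the Legendre symbol, and m = 2,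
    where every f_j is 0, identifies (2/p) with (-1)^S. *)
Lemma legendre_floor (p m : nat) : prime p -> odd p -> ~~ (p %| m)%N ->
  legendre m p * legendre 2 p ^+ (m - 1)
    = (-1) ^+ (\sum_(1 <= j < (halfp p).+1) (j * m) %/ p).
Proof.
move=> p_pr p_odd ndvd; have Dp := halfpK p_odd.
pose S := (\sum_(1 <= j < (halfp p).+1) j)%N.
have sqr1 n : (-1) ^+ n * (-1) ^+ n = 1%R :> int by rewrite -exprMn mulrNN mulr1 expr1n.
have parity k : ~~ (p %| k)%N ->
    (-1) ^+ (S * k) = (-1) ^+ (\sum_(1 <= j < (halfp p).+1) (j * k) %/ p)
                        * legendre k p * (-1) ^+ S :> int.
  move=> kndvd; rewrite gauss_lemma // /S -[X in _ * _ * (-1) ^+ X](big_absres p_pr p_odd kndvd).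
  rewrite big_distrl /= -!prodrXr -!big_split /=; apply: eq_bigr => j _.
  rewrite {1}(divn_eq (j * k) p) exprD mulnC exprM -signr_odd p_odd expr1 -mulrA.
  congr (_ * _); rewrite /absres; case: ifP => _; last by rewrite mul1r.
  rewrite expr1 mulN1r -[in RHS]signr_odd oddB ?p_odd; last exact/ltnW/ltn_pmod/prime_gt0.
  by rewrite -[in LHS]signr_odd; case: (odd _).
have ndvd2 : ~~ (p %| 2)%N by rewrite gtnNdvd //; move: (prime_gt1 p_pr); lia.
have leg2 : legendre 2 p = (-1) ^+ S.
  have := parity 2%N ndvd2; rewrite big_nat big1 => [|j Hj]; last by rewrite divn_small //; lia.
  rewrite expr0 mul1r muln2 -addnn exprD => E.
  by apply: (mulIf (_ : (-1) ^+ S != 0)); rewrite ?signr_eq0 ?E.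
have m0 : (0 < m)%N by case: (m) ndvd; rewrite ?dvdn0.
apply: (mulIf (_ : (-1) ^+ S != 0)); first by rewrite signr_eq0.
rewrite leg2 -exprM -mulrA -exprD -mulnSr subn1 prednK // parity //.
by rewrite gauss_lemma // -mulrA mulrCA mulrA mulrA -[X in X * _ = _]mulrA sqr1 mulr1.
Qed.

(** The lattice points with k <= m/2 and i <= h on the other side of the line number
    sum_j f_j, so the two floor sums add up to h floor(m/2); the rest is
    [legendre_floor]. *)
Lemma sign_product (p m : nat) : prime p -> odd p -> ~~ (p %| m)%N -> (0 < m)%N ->
  (-1) ^+ (halfp p * (m %/ 2)) * legendre m p * legendre 2 p ^+ (m - 1)
    = (-1) ^+ (\sum_(1 <= k < (m %/ 2).+1) (k * p) %/ m).
Proof.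
move=> p_pr p_odd ndvd m0; rewrite -mulrA legendre_floor // -exprD.
have cop : coprime p m by rewrite prime_coprime.
have -> : (\sum_(1 <= k < (m %/ 2).+1) (k * p) %/ m
    = \sum_(1 <= i < (halfp p).+1) (m %/ 2 - (i * m) %/ p))%N.
  apply/eqP; rewrite -(eqr_nat int) !natr_sum.
  rewrite -(sum_floor_swap (fun=> 1%R : int) p_odd cop m0).
  by apply/eqP/eq_bigr => k _; rewrite sumr_const_nat subn1.
rewrite -signr_odd -[RHS]signr_odd; congr (_ ^+ nat_of_bool _).
have -> : (halfp p * (m %/ 2) = \sum_(1 <= i < (halfp p).+1) (m %/ 2))%N.
  by rewrite sum_nat_const_nat subn1.
have -> : (\sum_(1 <= i < (halfp p).+1) (m %/ 2)
   = \sum_(1 <= i < (halfp p).+1) (m %/ 2 - (i * m) %/ p)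
     + \sum_(1 <= i < (halfp p).+1) (i * m) %/ p)%N.
  rewrite -big_split /= big_nat [RHS]big_nat; apply: eq_bigr => i /andP[_ Hi].
  by rewrite subnK ?floor_low.
by rewrite -addnA addnn oddD odd_double addbF.
Qed.

(** * The local ring at a polynomial modulus *)

Lemma qint_geom (A : comNzRingType) (x : A) (n : nat) :
  (1 - x) * qint x n = 1 - x ^+ n.
Proof.
rewrite /qint big_mkord; apply/eqP.
by rewrite -eqr_opp -mulNr !opprB -subrX1.
Qed.

Section LocalRing.

Variable M : {poly rat}.
Hypothesis M_nonconst : (1 < size M)%N.

(** For irreducible M this is the local ring of Q[q] at M; the congruences modulo M^k
    are those modulo the ideal generated by M^k in it, see [ratfun_eqmodP]. *)
Definition regular_at (x : ratfun) : Prop :=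
  exists F G : {poly rat}, coprimep G M /\ x = tofrac F / tofrac G.

Lemma coprime_neq0 (G : {poly rat}) : coprimep G M -> tofrac G != 0.
Proof.
move=> cop; rewrite tofrac_eq0; apply: contraL cop => /eqP ->.
by rewrite coprime0p -size_poly_eq1 neq_ltn M_nonconst orbT.
Qed.

Lemma regular_at_tofrac (F : {poly rat}) : regular_at (tofrac F).
Proof. by exists F, 1; rewrite coprime1p tofrac1 divr1. Qed.

Lemma regular_at_tofracV (G : {poly rat}) : coprimep G M -> regular_at (tofrac G)^-1.
Proof. by exists 1, G; rewrite tofrac1 div1r. Qed.

Lemma regular_atD (x y : ratfun) : regular_at x -> regular_at y -> regular_at (x + y).
Proof.
move=> [F1 [G1 [c1 ->]]] [F2 [G2 [c2 ->]]].
exists (F1 * G2 + F2 * G1), (G1 * G2); split; first by rewrite coprimepMl c1.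
by rewrite tofracD !tofracM addf_div ?coprime_neq0.
Qed.

Lemma regular_atM (x y : ratfun) : regular_at x -> regular_at y -> regular_at (x * y).
Proof.
move=> [F1 [G1 [c1 ->]]] [F2 [G2 [c2 ->]]].
exists (F1 * F2), (G1 * G2); split; first by rewrite coprimepMl c1.
by rewrite !tofracM mulf_div.
Qed.

Lemma regular_at_int (n : int) : regular_at n%:~R.
Proof. by rewrite -(rmorph_int (@tofrac {poly rat})); apply: regular_at_tofrac. Qed.

Lemma regular_at_nat (n : nat) : regular_at n%:R.
Proof. exact: (regular_at_int n). Qed.

Lemma regular_at0 : regular_at 0. Proof. exact: (regular_at_nat 0). Qed.
Lemma regular_at1 : regular_at 1. Proof. exact: (regular_at_nat 1). Qed.

Lemma regular_atN (x : ratfun) : regular_at x -> regular_at (- x).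
Proof.
by move=> Ix; rewrite -mulN1r; apply: regular_atM => //; apply: (regular_at_int (-1)).
Qed.

Lemma regular_atB (x y : ratfun) : regular_at x -> regular_at y -> regular_at (x - y).
Proof. by move=> Ix Iy; apply: regular_atD => //; apply: regular_atN. Qed.

Lemma regular_atX (x : ratfun) (n : nat) : regular_at x -> regular_at (x ^+ n).
Proof.
move=> Ix; elim: n => [|n IH]; first exact: regular_at1.
by rewrite exprS; apply: regular_atM.
Qed.

Lemma regular_at_sum (I : eqType) (r : seq I) (F : I -> ratfun) :
  (forall i, i \in r -> regular_at (F i)) -> regular_at (\sum_(i <- r) F i).
Proof.
move=> IF; rewrite big_seq; apply: big_ind => //; [exact: regular_at0|exact: regular_atD].
Qed.

Lemma ratfun_eqmodP (A B : ratfun) (k : nat) :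
  ratfun_eqmod A B M k <->
  exists2 z, regular_at z & A - B = tofrac M ^+ k * z.
Proof.
rewrite /ratfun_eqmod; split=> [[F [G [cop ->]]]|[_ [F [G [cop ->]]] ->]]; last by exists F, G.
by exists (tofrac F / tofrac G) => //; exists F, G.
Qed.

Lemma eqmod_refl (A : ratfun) (k : nat) : ratfun_eqmod A A M k.
Proof. by apply/ratfun_eqmodP; exists 0; [exact: regular_at0|rewrite subrr mulr0]. Qed.

Lemma eqmod_sym (A B : ratfun) (k : nat) :
  ratfun_eqmod A B M k -> ratfun_eqmod B A M k.
Proof.
move=> /ratfun_eqmodP[z Iz E]; apply/ratfun_eqmodP; exists (- z); first exact: regular_atN.
by rewrite mulrN -E opprB.
Qed.

Lemma eqmod_trans (B A C : ratfun) (k : nat) :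
  ratfun_eqmod A B M k -> ratfun_eqmod B C M k -> ratfun_eqmod A C M k.
Proof.
move=> /ratfun_eqmodP[z Iz E] /ratfun_eqmodP[w Iw D]; apply/ratfun_eqmodP; exists (z + w).
  exact: regular_atD.
by rewrite mulrDr -E -D addrA subrK.
Qed.

Lemma eqmodD (A B C D : ratfun) (k : nat) :
  ratfun_eqmod A B M k -> ratfun_eqmod C D M k -> ratfun_eqmod (A + C) (B + D) M k.
Proof.
move=> /ratfun_eqmodP[z Iz E] /ratfun_eqmodP[w Iw G]; apply/ratfun_eqmodP; exists (z + w).
  exact: regular_atD.
by rewrite mulrDr -E -G opprD addrACA.
Qed.

Lemma eqmodN (A B : ratfun) (k : nat) :
  ratfun_eqmod A B M k -> ratfun_eqmod (- A) (- B) M k.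
Proof.
move=> /ratfun_eqmodP[z Iz E]; apply/ratfun_eqmodP; exists (- z).
  exact: regular_atN.
by rewrite mulrN -E opprB opprK addrC.
Qed.

Lemma eqmodMl (C A B : ratfun) (k : nat) :
  regular_at C -> ratfun_eqmod A B M k -> ratfun_eqmod (C * A) (C * B) M k.
Proof.
move=> IC /ratfun_eqmodP[z Iz E]; apply/ratfun_eqmodP; exists (C * z); first exact: regular_atM.
by rewrite -mulrBr E mulrCA.
Qed.

Lemma eqmod_sum (I : eqType) (r : seq I) (F G : I -> ratfun) (k : nat) :
  (forall i, i \in r -> ratfun_eqmod (F i) (G i) M k) ->
  ratfun_eqmod (\sum_(i <- r) F i) (\sum_(i <- r) G i) M k.
Proof.
move=> FG; rewrite big_seq [X in ratfun_eqmod _ X]big_seq.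
apply: (big_ind2 (fun x y => ratfun_eqmod x y M k)) => //; first exact: eqmod_refl.
by move=> *; apply: eqmodD.
Qed.

End LocalRing.

(** * Coprimality of 1 - q^a and [p]_q *)

Lemma dvdp_sub1_exp (x : {poly rat}) (n : nat) : 1 - x %| 1 - x ^+ n.
Proof. by rewrite -qint_geom dvdp_mulIl. Qed.

Lemma qint_horner1 (p : nat) : (qint ('X : {poly rat}) p).[1] = p%:R.
Proof.
rewrite /qint horner_sum (eq_bigr (fun=> 1)) => [|i _]; last by rewrite hornerXn expr1n.
by rewrite sumr_const_nat subn0.
Qed.

(** A common divisor of 1 - X^a and [p]_X divides 1 - X^p, hence 1 - X since a is
    invertible modulo p. As [p]_X takes the value p at X = 1, it also divides the
    nonzero constant p. *)
Lemma coprime_1subX_qint (p a : nat) : prime p -> ~~ (p %| a)%N ->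
  coprimep (1 - 'X^a : {poly rat}) (qint 'X p).
Proof.
move=> p_pr ndvd; set M := qint _ _.
have MX : M %| 1 - 'X^p by rewrite -qint_geom dvdp_mulIr.
apply/coprimepP => d d_a d_M.
have a_gt0 : (0 < a)%N by case: (a) ndvd; rewrite ?dvdn0.
have [u v Euv _] := egcdnP p a_gt0.
have cop : gcdn a p = 1%N by apply/eqP; rewrite gcdnC; move: ndvd; rewrite -prime_coprime.
have d_X : d %| 1 - 'X.
  have -> : 1 - 'X = (1 - ('X^a) ^+ u) - 'X * (1 - ('X^p) ^+ v) :> {poly rat}.
    by rewrite -!exprM mulnC Euv cop addn1 (mulnC v) exprS; ring.
  rewrite dvdp_sub //; first exact: dvdp_trans d_a (dvdp_sub1_exp _ _).
  by rewrite dvdp_mull //; apply: dvdp_trans (dvdp_trans d_M MX) (dvdp_sub1_exp _ _).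
have d_p : d %| (p%:R : rat)%:P.
  rewrite -(qint_horner1 p) -/M -[_%:P](subKr M) dvdp_sub //.
  apply: dvdp_trans d_X _; rewrite -dvdpNl opprB.
  by rewrite -['X - 1]/('X - 1%:P) dvdp_XsubCl rootE !hornerE subrr.
rewrite -size_poly_eq1 -dvdp1; apply: dvdp_trans d_p _.
by rewrite dvdp1 size_polyC pnatr_eq0 -lt0n prime_gt0.
Qed.

Lemma size_qint (p : nat) : size (qint ('X : {poly rat}) p) = p.
Proof.
case: p => [|n]; first by rewrite /qint big_geq ?size_poly0.
have := qint_geom ('X : {poly rat}) n.+1 => /(congr1 (fun P : {poly rat} => size (- P))).
rewrite -mulNr !opprB size_XnsubC // size_monicM ?monicXsubC //; last first.
  apply/negP => /eqP q0; have := qint_horner1 n.+1.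
  by rewrite q0 horner0 => /eqP; rewrite eq_sym pnatr_eq0.
by rewrite size_XsubC => -[].
Qed.

Lemma subr1_qvarX_neq0 (n : nat) : (0 < n)%N -> 1 - qvar ^+ n != 0.
Proof.
move=> n0; rewrite /qvar -tofracXn -tofrac1 -tofracB tofrac_eq0 -oppr_eq0 opprB.
by rewrite -size_poly_gt0 size_XnsubC.
Qed.

(** * Regrouping products over a full system of residues *)

(** The odd numbers below 2h+1 are the 2h+1-2i for i = 1..h. *)
Lemma prod_parity_split (R : comNzRingType) (F : nat -> R) h :
  \prod_(1 <= j < h.*2.+1) F j
    = \prod_(1 <= i < h.+1) (F i.*2 * F (h.*2.+1 - i.*2)%N).
Proof.
have -> : \prod_(1 <= i < h.+1) (F i.*2 * F (h.*2.+1 - i.*2)%N)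
    = \prod_(1 <= i < h.+1) (F i.*2 * F i.*2.-1).
  rewrite !big_split /=; congr (_ * _); rewrite big_nat_rev /=.
  by rewrite big_nat [RHS]big_nat; apply: eq_bigr => i Hi; congr (F _); lia.
elim: h => [|h IH]; first by rewrite !big_geq.
rewrite doubleS big_nat_recr //= big_nat_recr //= IH [in RHS]big_nat_recr //=.
by rewrite -mulrA [F _ * F _]mulrC.
Qed.

Lemma prod_reflect_split (R : comNzRingType) (F : nat -> R) h :
  \prod_(1 <= j < h.*2.+1) F j
    = \prod_(1 <= i < h.+1) (F i * F (h.*2.+1 - i)%N).
Proof.
rewrite (big_cat_nat (n := h.+1)) //=; last by lia.
rewrite big_split /=; congr (_ * _); rewrite [RHS]big_nat_rev /= -[in LHS]add1n big_addn.
have -> : (h.*2.+1 - h = h.+1)%N by lia.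
by rewrite big_nat [RHS]big_nat; apply: eq_bigr => i Hi; congr (F _); lia.
Qed.

Lemma qpochE (K : fieldType) (x : K) n :
  qpoch x x n = \prod_(1 <= j < n.+1) (1 - x ^+ j).
Proof. by rewrite /qpoch big_add1; apply: eq_bigr => i _; rewrite -exprS. Qed.

(** * First-order expansions in 1 - q^p *)

Section FieldIdentities.

Variables (K : fieldType) (u x y : K).
Hypotheses (x1 : 1 - x != 0) (y1 : 1 - y != 0).

Lemma inv_sub1B : (1 - x)^-1 - (1 - y)^-1 = (1 - x)^-1 * (1 - y)^-1 * (x - y).
Proof. by field; rewrite x1 y1. Qed.

Lemma inv_sub1_reflect :
  1 - (1 - x)^-1 - (1 - y)^-1 = (1 - x)^-1 * (1 - y)^-1 * (x * y - 1).
Proof. by field; rewrite x1 y1. Qed.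

Lemma subr_ratio : (1 - u * y) / (1 - y) = 1 + (u - 1) * (1 - (1 - y)^-1).
Proof. by field. Qed.

Lemma subr_ratioB : (u - y) / (1 - y) = 1 + (u - 1) / (1 - y).
Proof. by field. Qed.

End FieldIdentities.

Section Expansions.

Variable p : nat.
Hypotheses (p_pr : prime p) (p_odd : odd p).

Let Dp := halfpK p_odd.

Notation Phi := (qint ('X : {poly rat}) p).
Notation "A == B 'mod' k" := (ratfun_eqmod A B Phi k) (at level 70, B at next level).
Notation q := qvar.
Notation intg := (regular_at Phi).
Notation t := (1 - q ^+ p).

Let Phi_nc : (1 < size Phi)%N.
Proof. by rewrite size_qint prime_gt1. Qed.

Lemma tofrac_qint : tofrac Phi = qint q p.
Proof. by rewrite /qint rmorph_sum; apply: eq_bigr => i _; rewrite rmorphXn. Qed.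

Lemma subr1_qvarX : t = (1 - q) * tofrac Phi.
Proof. by rewrite tofrac_qint qint_geom. Qed.

Lemma regular_at_qvarX n : intg (q ^+ n).
Proof. by rewrite /qvar -tofracXn; apply: regular_at_tofrac. Qed.

Lemma regular_at_inv n : ~~ (p %| n)%N -> intg (1 - q ^+ n)^-1.
Proof.
move=> ndvd; rewrite /qvar -tofracXn -tofrac1 -tofracB.
exact/regular_at_tofracV/coprime_1subX_qint.
Qed.

Lemma qvarX_eqmod a b : a = b %[mod p] -> q ^+ a == q ^+ b mod 1.
Proof.
wlog le_ba : a b / (b <= a)%N.
  move=> W E; case/orP: (leq_total a b) => le; last exact: W.
  by apply: eqmod_sym; apply: W.
move=> /eqP; rewrite eqn_mod_dvd // => /dvdnP[k Ek].
have -> : q ^+ a = q ^+ b * (q ^+ p) ^+ k by rewrite -exprM -exprD mulnC -Ek subnKC.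
apply/ratfun_eqmodP; exists (- q ^+ b * (1 - q) * qint (q ^+ p) k).
  apply: regular_atM => //; first apply: regular_atM => //.
  - exact/regular_atN/regular_at_qvarX.
  - by apply: regular_atB => //; [apply: regular_at1 | apply: (regular_at_qvarX 1)].
  - by apply: regular_at_sum => // i _; apply: regular_atX => //; apply: regular_at_qvarX.
have := qint_geom (q ^+ p) k; rewrite subr1_qvarX => E.
transitivity (- q ^+ b * (1 - (q ^+ p) ^+ k)); first by ring.
by rewrite -E; ring.
Qed.

Lemma inv_eqmod a b : ~~ (p %| a)%N -> a = b %[mod p] ->
  (1 - q ^+ a)^-1 == (1 - q ^+ b)^-1 mod 1.
Proof.
move=> ap ab; have bp : ~~ (p %| b)%N by rewrite /dvdn -ab.
have n0 n : ~~ (p %| n)%N -> (1 - q ^+ n) != 0.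
  by move=> np; apply: subr1_qvarX_neq0; case: n np; rewrite ?dvdn0.
have /ratfun_eqmodP[z Iz E] := qvarX_eqmod ab.
apply/ratfun_eqmodP; exists ((1 - q ^+ a)^-1 * (1 - q ^+ b)^-1 * z).
  by apply: regular_atM => //; apply: regular_atM => //; apply: regular_at_inv.
by rewrite mulrCA -E inv_sub1B ?n0.
Qed.

(** With x = q^a and y = q^b, x y = 1 modulo [p]_q, and 1/(1-x) + 1/(1-1/x) = 1. *)
Lemma inv_reflect_eqmod a b : ~~ (p %| a)%N -> (p %| a + b)%N ->
  1 - (1 - q ^+ a)^-1 == (1 - q ^+ b)^-1 mod 1.
Proof.
move=> ap ab; have bp : ~~ (p %| b)%N by apply: contra ap => bp; rewrite -(dvdn_addl a bp).
have n0 n : ~~ (p %| n)%N -> (1 - q ^+ n) != 0.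
  by move=> np; apply: subr1_qvarX_neq0; case: n np; rewrite ?dvdn0.
have ab0 : (a + b = 0 %[mod p])%N by rewrite mod0n; apply/eqP.
have /ratfun_eqmodP[z Iz E] := qvarX_eqmod ab0.
apply/ratfun_eqmodP; exists ((1 - q ^+ a)^-1 * (1 - q ^+ b)^-1 * z).
  by do 2?[apply: regular_atM => //]; apply: regular_at_inv.
by rewrite mulrCA -E expr0 exprD -inv_sub1_reflect ?n0.
Qed.

(** Since t^2 = 0 modulo [p]_q^2, the map a -> 1 + t a sends sums to products, and
    only the class of a modulo [p]_q matters. *)
Definition expands (A a : ratfun) : Prop := intg a /\ A == 1 + t * a mod 2.

Lemma expands1 : expands 1 0.
Proof. by split; [exact: regular_at0|rewrite mulr0 addr0; exact: eqmod_refl]. Qed.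

Lemma expands_eqmod A a b : intg b -> a == b mod 1 -> expands A a -> expands A b.
Proof.
move=> Ib /ratfun_eqmodP[z Iz E] [Ia HA]; split=> //; apply: eqmod_trans HA _ => //.
apply/ratfun_eqmodP; exists ((1 - q) * z).
  apply: regular_atM => //.
  by apply: regular_atB => //; [apply: regular_at1 | apply: (regular_at_qvarX 1)].
have -> : a = b + tofrac Phi ^+ 1 * z by rewrite -E; ring.
by rewrite subr1_qvarX; ring.
Qed.

Lemma expandsM A B a b : expands A a -> expands B b -> expands (A * B) (a + b).
Proof.
move=> [Ia /ratfun_eqmodP[z Iz EA]] [Ib /ratfun_eqmodP[w Iw EB]]; split; first exact: regular_atD.
have I1q : intg (1 - q).
  by apply: regular_atB => //; [apply: regular_at1 | apply: (regular_at_qvarX 1)].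
have -> : A = 1 + t * a + tofrac Phi ^+ 2 * z by rewrite -EA; ring.
have -> : B = 1 + t * b + tofrac Phi ^+ 2 * w by rewrite -EB; ring.
have It : intg t by apply: regular_atB => //; [apply: regular_at1 | apply: regular_at_qvarX].
apply/ratfun_eqmodP; exists ((1 - q) ^+ 2 * (a * b) + (1 + t * a) * w + z * (1 + t * b)
                       + tofrac Phi ^+ 2 * (z * w)); last first.
  by rewrite subr1_qvarX; ring.
have I1 c : intg c -> intg (1 + t * c).
  by move=> Ic; apply: regular_atD => //; [apply: regular_at1|apply: regular_atM].
apply: regular_atD => //; first apply: regular_atD => //; first apply: regular_atD => //.
- by apply: regular_atM => //; [apply: regular_atX|apply: regular_atM].
- by apply: regular_atM => //; apply: I1.
- by apply: regular_atM => //; apply: I1.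
- by apply: regular_atM => //; [apply/regular_atX/regular_at_tofrac|apply: regular_atM].
Qed.

Lemma expandsX A a n : expands A a -> expands (A ^+ n) (a *+ n).
Proof.
move=> HA; elim: n => [|n IH]; first exact: expands1.
by rewrite exprS mulrS; apply: expandsM.
Qed.

Lemma expands_prod (m n : nat) (A a : nat -> ratfun) :
  (forall i, (m <= i < n)%N -> expands (A i) (a i)) ->
  expands (\prod_(m <= i < n) A i) (\sum_(m <= i < n) a i).
Proof.
move=> HA; rewrite big_nat [X in expands _ X]big_nat.
apply: (big_ind2 expands) => //; first exact: expands1.
by move=> *; apply: expandsM.
Qed.

(** The starting point is q^p = 1 - t. *)
Lemma expands_qvarX n : expands (q ^+ (p * n)) (- n%:R).
Proof.
rewrite exprM -mulNrn; apply: expandsX; split.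
  by apply: regular_atN => //; apply: regular_at1.
by rewrite mulrN1 opprB addrC subrK; apply: eqmod_refl.
Qed.

(** As (1 - u y)/(1 - y) - 1 = -(u - 1) y/(1 - y), the coefficient is c times
    -y/(1 - y) = 1 - 1/(1 - y). *)
Lemma expands_ratio u c y : expands u c -> 1 - y != 0 -> intg (1 - y)^-1 ->
  expands ((1 - u * y) / (1 - y)) (c * (1 - (1 - y)^-1)).
Proof.
move=> [Ic /ratfun_eqmodP[z Iz E]] y1 Iy.
have Ic' : intg (1 - (1 - y)^-1) by apply: regular_atB => //; apply: regular_at1.
split; first exact: regular_atM.
apply/ratfun_eqmodP; exists (z * (1 - (1 - y)^-1)); first exact: regular_atM.
have -> : u = 1 + t * c + tofrac Phi ^+ 2 * z by rewrite -E; ring.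
by rewrite subr_ratio //; ring.
Qed.

Lemma expands_ratioB u c y : expands u c -> 1 - y != 0 -> intg (1 - y)^-1 ->
  expands ((u - y) / (1 - y)) (c / (1 - y)).
Proof.
move=> [Ic /ratfun_eqmodP[z Iz E]] y1 Iy.
split; first exact: regular_atM.
apply/ratfun_eqmodP; exists (z / (1 - y)); first exact: regular_atM.
have -> : u = 1 + t * c + tofrac Phi ^+ 2 * z by rewrite -E; ring.
by rewrite subr_ratioB //; ring.
Qed.

(** With x = q^a, the power of x is the product of the x^i for i = 1..n, and
    -x^i (1 - x^(p-i)) = x^p - x^i, so the left-hand side is the product of the
    (x^p - x^i)/(1 - x^i). *)
Lemma expands_qbinom a n : ~~ (p %| a)%N -> (n < p)%N ->
  expands ((-1) ^+ n * (q ^+ a) ^+ 'C(n + 1, 2) * qbinom (q ^+ a) p.-1 n)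
    (\sum_(1 <= i < n.+1) - (a%:R / (1 - q ^+ (a * i)))).
Proof.
move=> ap np; set x := q ^+ a.
have nz i : (1 <= i < n.+1)%N -> ~~ (p %| a * i)%N.
  by move=> Hi; rewrite Euclid_dvdM // negb_or ap gtnNdvd //; lia.
have nx i : (1 <= i < n.+1)%N -> 1 - x ^+ i != 0.
  move=> Hi; rewrite -exprM subr1_qvarX_neq0 //.
  by case: (a * i)%N (nz i Hi); rewrite ?dvdn0.
have -> : (-1) ^+ n * x ^+ 'C(n + 1, 2) * qbinom x p.-1 n
    = \prod_(1 <= i < n.+1) ((q ^+ (p * a) - x ^+ i) / (1 - x ^+ i)).
  rewrite /qbinom.
  have -> : (-1) ^+ n = \prod_(1 <= i < n.+1) (-1) :> ratfun.
    by rewrite prodr_const_nat subn1.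
  rewrite -[X in X / _](_ : \prod_(1 <= i < n.+1) (1 - x ^+ (p - i)) = _); last first.
    by rewrite big_add1; apply: eq_bigr => i _; rewrite -subn1 -subnDA add1n.
  rewrite -[X in _ / X](_ : \prod_(1 <= i < n.+1) (1 - x ^+ i) = _); last first.
    rewrite [RHS]big_nat_rev big_add1 /= [LHS]big_nat [RHS]big_nat.
    by apply: eq_bigr => i Hi; rewrite add0n subKn.
  have -> : 'C(n + 1, 2) = (\sum_(1 <= i < n.+1) i)%N.
    by rewrite addn1 -bin2_sum big_ltn // add0n.
  rewrite -prodrXr -prodf_div -!big_split /=.
  rewrite [LHS]big_nat [RHS]big_nat; apply: eq_bigr => i Hi. rewrite mulrA; congr (_ / _).
  rewrite mulN1r mulNr mulrBr mulr1 -exprD subnKC; last by lia.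
  by rewrite opprB -exprM mulnC.
apply: expands_prod => i Hi; rewrite -mulNr /x -exprM.
apply: expands_ratioB; first exact: expands_qvarX.
  by rewrite exprM nx.
exact/regular_at_inv/nz.
Qed.

(** Put y = q^a. In the numerator the exponents 2j split into 2i and 2(p-i), in the
    denominator the exponents j split into 2i and p-2i, for i = 1..h. The factors of
    exponent 2i cancel, and 2(p-i) = p + (p-2i) leaves (1 - y^p z)/(1 - z) with
    z = y^(p-2i). Its coefficient -a (1 - 1/(1-z)) is -a/(1 - y^(2i)) modulo [p]_q. *)
Lemma expands_qpoch_double a : ~~ (p %| a)%N ->
  expands (qpoch ((q ^+ a) ^+ 2) ((q ^+ a) ^+ 2) p.-1 / qpoch (q ^+ a) (q ^+ a) p.-1)
    (\sum_(1 <= i < (halfp p).+1) - (a%:R / (1 - q ^+ (2 * a * i)))).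
Proof.
move=> ap; set y := q ^+ a.
have ay n : ~~ (p %| n)%N -> ~~ (p %| a * n)%N.
  by move=> np; rewrite Euclid_dvdM // negb_or ap.
have nzp n : ~~ (p %| n)%N -> 1 - y ^+ n != 0.
  move=> /ay; rewrite -exprM => np; apply: subr1_qvarX_neq0.
  by case: (a * n)%N np; rewrite ?dvdn0.
have half_ndvd i : (1 <= i < (halfp p).+1)%N ->
    ~~ (p %| i.*2)%N /\ ~~ (p %| p - i.*2)%N.
  by move=> Hi; rewrite !gtnNdvd; lia.
have -> : qpoch (y ^+ 2) (y ^+ 2) p.-1 / qpoch y y p.-1 = \prod_(1 <= i < (halfp p).+1)
     ((1 - q ^+ (p * a) * y ^+ (p - i.*2)) / (1 - y ^+ (p - i.*2))).
  rewrite !qpochE prednK ?prime_gt0 //.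
  have -> : \prod_(1 <= j < p) (1 - y ^+ j)
      = \prod_(1 <= i < (halfp p).+1) ((1 - y ^+ i.*2) * (1 - y ^+ (p - i.*2))).
    by rewrite [in LHS]Dp prod_parity_split -Dp.
  have -> : \prod_(1 <= j < p) (1 - (y ^+ 2) ^+ j)
      = \prod_(1 <= i < (halfp p).+1) ((1 - (y ^+ 2) ^+ i) * (1 - (y ^+ 2) ^+ (p - i))).
    by rewrite [in LHS]Dp prod_reflect_split -Dp.
  rewrite -prodf_div big_nat [RHS]big_nat; apply: eq_bigr => i Hi.
  have [i2 pi2] := half_ndvd i Hi.
  rewrite -!(exprM y) !mul2n -mulf_div divff ?nzp // mul1r; congr ((1 - _) / _).
  by rewrite mulnC exprM -/y -exprD; congr (_ ^+ _); lia.
apply: expands_prod => i Hi; have [i2 pi2] := half_ndvd i Hi.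
have ratio := expands_ratio (expands_qvarX a) (nzp _ pi2).
apply: expands_eqmod (ratio _); last by rewrite -exprM; apply/regular_at_inv/ay.
  apply: regular_atN => //; apply: regular_atM => //; first exact: regular_at_nat.
  by apply: regular_at_inv; rewrite -mulnA mulnCA mul2n ay.
rewrite -mulNr; apply: eqmodMl => //; first by apply: regular_atN => //; apply: regular_at_nat.
rewrite -exprM; apply: inv_reflect_eqmod; first exact: ay.
by rewrite -mulnA mulnCA mul2n -mulnDr subnK ?dvdn_mull //; lia.
Qed.

End Expansions.

(** * The q-Euler quotient *)

Lemma legendre_sqr (p m : nat) : ~~ (p %| m)%N -> legendre m p * legendre m p = 1%R.
Proof. by rewrite /legendre => /negPf->; case: ifP. Qed.

Lemma sum_Rset (V : nmodType) (p m : nat) (F : nat -> V) : odd p ->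
  \sum_(j in Rset p m) F j
    = \sum_(1 <= j < (halfp p).+1) (if far p m j then F j else 0).
Proof.
move=> /halfpK Dp; have p_gt : ((halfp p).+1 <= p)%N by lia.
pose P j := [&& (1 <= j)%N, (2 * j < p)%N & far p m j].
under eq_bigl do rewrite inE -/(far p m _) -/(P _).
rewrite -(big_mkord P F) big_mkcond (big_cat_nat (n := 1)) //=; last by lia.
rewrite big_nat1 /= add0r (big_cat_nat (n := (halfp p).+1)) //=.
rewrite [X in _ + X]big_nat [X in _ + X]big1 ?addr0 => [|j Hj]; last first.
  by rewrite /P; case: ifP => // /and3P[_ ? _]; lia.
rewrite big_nat [RHS]big_nat; apply: eq_bigr => j Hj.
by rewrite /P; have [-> ->] : (1 <= j)%N /\ (2 * j < p)%N by lia.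
Qed.

Lemma card_Rset (p m : nat) : odd p ->
  #|Rset p m| = (\sum_(1 <= j < (halfp p).+1) far p m j)%N.
Proof.
move=> p_odd; rewrite -sum1_card (sum_Rset m (fun=> 1%N) p_odd).
by apply: eq_bigr => j _; case: (far p m j).
Qed.

(** The factor (1 + x^p)/(1 + x) turns [p]_(x^2) into [p]_x, because
    (1 - x)(1 + x)[p]_(x^2) = 1 - x^(2p) = (1 + x^p)(1 - x)[p]_x. *)
Lemma qEulerStarE (K : fieldType) (p m : nat) (x : K) :
  ~~ (p %| m)%N -> 1 - x != 0 -> 1 + x != 0 -> qint (x ^+ 2) p != 0 ->
  qEulerStar p m x =
    ((legendre m p)%:~R * x ^+ (2 * Rsum p m)
       * (qpoch (x ^+ (2 * m)) (x ^+ (2 * m)) (p.-1 %/ 2)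
            / qpoch (x ^+ 2) (x ^+ 2) (p.-1 %/ 2))
       - 1) / qint x p.
Proof.
move=> ndvd x1 x1' q2; rewrite /qEulerStar /qEuler -!exprM.
have l2 : (legendre m p)%:~R * (legendre m p)%:~R = 1 :> K by rewrite -intrM legendre_sqr.
have qE : (1 + x ^+ p) * qint x p = (1 + x) * qint (x ^+ 2) p.
  apply: (mulfI x1); rewrite mulrCA qint_geom mulrA.
  have -> : (1 - x) * (1 + x) = 1 - x ^+ 2 by ring.
  by rewrite qint_geom -exprM mulnC exprM; ring.
have q1 : qint x p != 0.
  by have := mulf_neq0 x1' q2; rewrite -qE mulf_eq0 negb_or => /andP[].
have -> : (1 + x ^+ p) = (1 + x) * qint (x ^+ 2) p / qint x p by rewrite -qE mulfK.
set A := x ^+ _ * (qpoch _ _ _ / _); set l := _%:~R in l2 *.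
have -> : l * x ^+ (2 * Rsum p m) * (qpoch (x ^+ (2 * m)) (x ^+ (2 * m)) (p.-1 %/ 2)
    / qpoch (x ^+ 2) (x ^+ 2) (p.-1 %/ 2)) - 1 = l * (A - l).
  by rewrite mulrBr l2 -mulrA.
by field; rewrite q1 x1'.
Qed.

Section Euler.

Variables p m : nat.
Hypotheses (p_pr : prime p) (p_odd : odd p) (ndvd : ~~ (p %| m)%N).

Notation Phi := (qint ('X : {poly rat}) p).
Notation "A == B 'mod' k" := (ratfun_eqmod A B Phi k) (at level 70, B at next level).
Notation q := qvar.
Notation near j := ((j * m) %/ p + far p m j)%N.
Notation G j := ((1 - q ^+ (2 * m * j))^-1).

Let Phi_nc : (1 < size Phi)%N.
Proof. by rewrite size_qint prime_gt1. Qed.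

Let ndvd2 n : ~~ (p %| n)%N -> ~~ (p %| 2 * n)%N.
Proof.
by move=> np; rewrite Euclid_dvdM // negb_or np gtnNdvd //; move: (prime_gt1 p_pr); lia.
Qed.

(** Let g = absres p m j and u = q^(2p). In the near case q^(2mj) = u^f q^(2g) with
    f = floor(jm/p), and the ratio is (1 - u^f y)/(1 - y) with y = q^(2g). In the far
    case q^(2g) q^(2mj) = u^(f+1), and it is (u^(f+1) - y)/(1 - y) after absorbing
    the sign. Replacing 1/(1-y) by G j, respectively by 1 - G j, modulo [p]_q gives
    the same formula in terms of f + rho, the integer nearest to jm/p. *)
Lemma expands_euler_factor j : (1 <= j < (halfp p).+1)%N ->
  expands p
    ((-1) ^+ far p m j * q ^+ (2 * (if far p m j then absres p m j else 0))
       * ((1 - q ^+ (2 * m * j)) / (1 - q ^+ (2 * absres p m j))))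
    ((2 * near j)%:R * (G j - 1)).
Proof.
move=> Hj; have jm : ~~ (p %| j * m)%N by apply: ndvd_mul => //; apply: ndvd_low Hj.
have Emj : (2 * m * j = 2 * (j * m))%N by rewrite -mulnA [(m * j)%N]mulnC.
have g_ndvd : ~~ (p %| 2 * absres p m j)%N.
  by apply/ndvd2/(ndvd_low p_odd)/absres_low.
have g_neq0 : 1 - q ^+ (2 * absres p m j) != 0.
  by apply: subr1_qvarX_neq0; case: (_ * _)%N g_ndvd; rewrite ?dvdn0.
have reg : regular_at Phi ((2 * near j)%:R * (G j - 1)).
  apply: regular_atM => //; first exact: regular_at_nat.
  by apply: regular_atB => //; [rewrite Emj; apply/regular_at_inv/ndvd2|apply: regular_at1].
rewrite Emj in reg *.
have flip (a b : ratfun) : a * (b - 1) = - a * (1 - b) by rewrite mulNr -mulrN opprB.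
have lt_p := ltn_pmod (j * m) (prime_gt0 p_pr).
have Ejm := divn_eq (j * m) p.
have [far_j|near_j] := boolP (far p m j).
  have Eg : (absres p m j = p - (j * m) %% p)%N by rewrite /absres far_j.
  have Esum : (2 * absres p m j + 2 * (j * m) = p * (2 * near j))%N.
    by rewrite far_j; nia.
  rewrite far_j -[nat_of_bool true]/1%N in Esum reg *.
  rewrite expr1 mulN1r mulrA mulNr mulrBr mulr1 -exprD opprB Esum.
  have := expands_ratioB (expands_qvarX p_pr (2 * ((j * m) %/ p + 1))) g_neq0
            (regular_at_inv p_pr g_ndvd).
  apply: expands_eqmod => //.
  rewrite flip.
  apply: eqmodMl => //; first by apply: regular_atN => //; apply: regular_at_nat.
  apply: eqmod_sym => //; apply: inv_reflect_eqmod => //.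
    by rewrite ndvd2.
  by rewrite addnC Esum dvdn_mulr.
have Eg : (absres p m j = (j * m) %% p)%N by rewrite /absres (negPf near_j).
rewrite (negPf near_j) addn0 in reg *; rewrite muln0 expr0 !mul1r Eg in g_ndvd g_neq0 *.
have E2 : (2 * (j * m) = p * (2 * ((j * m) %/ p)) + 2 * ((j * m) %% p))%N by nia.
rewrite {1}E2 exprD.
have := expands_ratio p_pr (expands_qvarX p_pr (2 * ((j * m) %/ p))) g_neq0
          (regular_at_inv p_pr g_ndvd).
apply: expands_eqmod => //.
rewrite flip.
apply: eqmodMl => //; first by apply: regular_atN => //; apply: regular_at_nat.
apply: eqmodD => //; first exact: eqmod_refl.
apply: eqmodN; apply: inv_eqmod => //.
by rewrite E2 [(p * _)%N]mulnC modnMDl.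
Qed.

Lemma expands_euler :
  expands p
    ((legendre m p)%:~R * q ^+ (2 * Rsum p m)
       * (qpoch (q ^+ (2 * m)) (q ^+ (2 * m)) (halfp p)
            / qpoch (q ^+ 2) (q ^+ 2) (halfp p)))
    (\sum_(1 <= j < (halfp p).+1) (2 * near j)%:R * (G j - 1)).
Proof.
have -> : (legendre m p)%:~R * q ^+ (2 * Rsum p m)
       * (qpoch (q ^+ (2 * m)) (q ^+ (2 * m)) (halfp p)
            / qpoch (q ^+ 2) (q ^+ 2) (halfp p))
  = \prod_(1 <= j < (halfp p).+1)
      ((-1) ^+ far p m j * q ^+ (2 * (if far p m j then absres p m j else 0))
         * ((1 - q ^+ (2 * m * j)) / (1 - q ^+ (2 * absres p m j)))).
  rewrite gauss_lemma // rmorphXn /= rmorphN1 !qpochE.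
  have -> : Rsum p m
      = (\sum_(1 <= j < (halfp p).+1) if far p m j then absres p m j else 0)%N.
    rewrite /Rsum (sum_Rset m (fun j => p - (j * m) %% p)%N p_odd).
    by apply: eq_bigr => j _; rewrite /absres; case: (far p m j).
  rewrite big_split /= prodf_div [X in _ = X * _]big_split /= !prodrXr.
  rewrite big_distrr /=; congr (_ * (_ / _)).
    by apply: eq_bigr => j _; rewrite -exprM.
  rewrite -(big_absres p_pr p_odd ndvd); apply: eq_bigr => j _.
  by rewrite -exprM.
by apply: expands_prod => // j Hj; apply: expands_euler_factor.
Qed.

(** Summing over the permuted indices absres p m j instead, each term is congruent to
    G j in the near case and to 1 - G j in the far case. *)
Lemma sum_inv_absres :
  \sum_(1 <= j < (halfp p).+1) (1 - q ^+ (2 * j))^-1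
    == \sum_(1 <= j < (halfp p).+1) ((far p m j)%:R * (1 - 2 * G j) + G j) mod 1.
Proof.
rewrite -(big_absres p_pr p_odd ndvd _ (fun j => (1 - q ^+ (2 * j))^-1)).
apply: eqmod_sum => // j; rewrite mem_index_iota => Hj.
have g_ndvd : ~~ (p %| 2 * absres p m j)%N.
  by apply/ndvd2/(ndvd_low p_odd)/absres_low.
have := absres_mod m p_pr j; have [_|_] /= := boolP (far p m j) => Hg.
  rewrite mul1r; have -> : 1 - 2 * G j + G j = 1 - G j by ring.
  apply/eqmod_sym/inv_reflect_eqmod => //.
    by rewrite -mulnA [(m * j)%N]mulnC; apply/ndvd2/(ndvd_mul p_pr ndvd)/(ndvd_low p_odd).
  by rewrite -mulnA [(m * j)%N]mulnC -mulnDr dvdn_mull.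
rewrite mul0r add0r; apply: inv_eqmod => //.
by rewrite -mulnA [(m * j)%N]mulnC -modnMmr -(eqP Hg) modnMmr.
Qed.

End Euler.

(** * The congruence *)

Lemma expands_qbinom_product (p m : nat) : prime p -> odd p -> ~~ (p %| m)%N -> (0 < m)%N ->
  expands p
    ((-1) ^+ (halfp p * (m %/ 2)) * (legendre m p)%:~R * (legendre 2 p)%:~R ^+ (m - 1)
       * qvar ^+ (2 * m * \sum_(1 <= k < (m %/ 2).+1) 'C((k * p) %/ m + 1, 2))
       * \prod_(1 <= k < (m %/ 2).+1) qbinom (qvar ^+ (2 * m)) p.-1 ((k * p) %/ m))
    (\sum_(1 <= i < (halfp p).+1)
        - ((2 * m)%:R / (1 - qvar ^+ (2 * m * i))) *+ (m %/ 2 - (i * m) %/ p)).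
Proof.
move=> p_pr p_odd ndvd m0; have cop : coprime p m by rewrite prime_coprime.
rewrite -(sum_floor_swap (fun i => - ((2 * m)%:R / (1 - qvar ^+ (2 * m * i)))) p_odd cop m0).
have -> : (-1) ^+ (halfp p * (m %/ 2)) * (legendre m p)%:~R * (legendre 2 p)%:~R ^+ (m - 1)
   = (-1) ^+ (\sum_(1 <= k < (m %/ 2).+1) (k * p) %/ m) :> ratfun.
  have := sign_product p_pr p_odd ndvd m0 => /(congr1 (fun z : int => z%:~R : ratfun)).
  by rewrite !(rmorphM, rmorphXn, rmorphN1).
rewrite exprM -!prodrXr -!big_split /=.
apply: expands_prod => // k Hk; apply: expands_qbinom => //.
  rewrite Euclid_dvdM // negb_or ndvd gtnNdvd //; lia.
rewrite ltn_divLR // mulnC ltn_pmul2l ?prime_gt0 //.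
by have := leq_divM m 2; lia.
Qed.

(** The first-order coefficients on both sides agree before anything is reduced modulo
    [p]_q: with f = floor(jm/p) and rho marking the far indices, the left-hand side is the
    coefficient of the q-binomial product, and on the right are those of the q-Euler
    product, of the q-Fermat product at q^m, of the q-Fermat product at q (in the form
    given by [sum_inv_absres]) and of the explicit multiple of 1 - q^p. *)
Lemma expansions_balance (p m : nat) (G : nat -> ratfun) (f : nat -> nat) (rho : nat -> bool) :
  (forall i, (1 <= i < (halfp p).+1)%N -> (f i <= m %/ 2)%N) ->
  \sum_(1 <= i < (halfp p).+1) - ((2 * m)%:R * G i) *+ (m %/ 2 - f i)
  = m%:R * (\sum_(1 <= i < (halfp p).+1) (2 * (f i + rho i))%:R * (G i - 1))
    + (2 * (m %/ 2) + 1)%:R * (\sum_(1 <= i < (halfp p).+1) - (m%:R * G i))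
    + m%:R * (\sum_(1 <= i < (halfp p).+1) ((rho i)%:R * (1 - 2 * G i) + G i))
    + m%:R * (\sum_(1 <= i < (halfp p).+1) (rho i) + 2 * \sum_(1 <= i < (halfp p).+1) f i)%:R.
Proof.
move=> le_f; rewrite (natrD _ (\sum_(1 <= i < _) _)%N) (natrM _ 2 (\sum_(1 <= i < _) _)%N) !natr_sum.
rewrite [2 * _]mulr_sumr -big_split /= !mulr_sumr -!big_split /=.
rewrite big_nat [RHS]big_nat; apply: eq_bigr => i Hi.
rewrite -[- _ *+ _]mulr_natr natrB ?le_f //.
rewrite !(natrM, natrD) /=; ring.
Qed.

(** In the application L is the q-binomial product, E the q-Euler product, and A and B
    are the q-Fermat products at q^m and at q. *)
Lemma eqmod_of_expansions (p i j : nat) (L E A B a b c d n : ratfun) : prime p ->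
  expands p L (i%:R * a + j%:R * b + i%:R * c + n) ->
  expands p E a -> expands p A b -> expands p B (- d) ->
  ratfun_eqmod d c (qint 'X p) 1 ->
  ratfun_eqmod L
    (1 + i%:R * (E - 1) + j%:R * (A - 1) - i%:R * (B - 1) + n * (1 - qvar ^+ p))
    (qint 'X p) 2.
Proof.
move=> p_pr [_ /ratfun_eqmodP[zL IL EL]] [_ /ratfun_eqmodP[zE IE EE]].
move=> [_ /ratfun_eqmodP[zA IA EA]] [_ /ratfun_eqmodP[zB IB EB]] /ratfun_eqmodP[z0 I0 E0].
have Phi_nc : (1 < size (qint ('X : {poly rat}) p))%N by rewrite size_qint prime_gt1.
have I1q : regular_at (qint ('X : {poly rat}) p) (1 - qvar).
  by apply: regular_atB => //; [apply: regular_at1|apply: (regular_at_qvarX p 1)].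
have Inat k x : regular_at (qint ('X : {poly rat}) p) x ->
    regular_at (qint ('X : {poly rat}) p) (k%:R * x).
  by move=> Ix; apply: regular_atM => //; apply: regular_at_nat.
apply/ratfun_eqmodP.
(* The error terms combine as L, E, A and B do; d - c contributes (1-q) times its own. *)
exists (zL - i%:R * zE - j%:R * zA + i%:R * zB - i%:R * ((1 - qvar) * z0)).
  by do ?[apply: regular_atB => // | apply: regular_atD => // | apply: Inat => //];
     apply: regular_atM.
have -> : L = tofrac (qint 'X p) ^+ 2 * zL
    + (1 + (1 - qvar ^+ p) * (i%:R * a + j%:R * b + i%:R * c + n)) by rewrite -EL subrK.
have -> : E = tofrac (qint 'X p) ^+ 2 * zE + (1 + (1 - qvar ^+ p) * a) by rewrite -EE subrK.
have -> : A = tofrac (qint 'X p) ^+ 2 * zA + (1 + (1 - qvar ^+ p) * b) by rewrite -EA subrK.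
have -> : B = tofrac (qint 'X p) ^+ 2 * zB + (1 + (1 - qvar ^+ p) * - d) by rewrite -EB subrK.
have -> : d = tofrac (qint 'X p) ^+ 1 * z0 + c by rewrite -E0 subrK.
rewrite subr1_qvarX; ring.
Qed.

Theorem theorem1p1 (p m : nat) (p_prime : prime p) (p_ge5 : (5 <= p)%N)
    (m_ge2 : (2 <= m)%N) (p_ndvd_m : ~~ (p %| m)%N) :
  qEulerStar p m qvar =
    ((legendre m p)%:~R * qvar ^+ (2 * Rsum p m)
       * (qpoch (qvar ^+ (2 * m)) (qvar ^+ (2 * m)) (p.-1 %/ 2)
            / qpoch (qvar ^+ 2) (qvar ^+ 2) (p.-1 %/ 2))
       - 1) / qint qvar p
  /\
  ratfun_eqmod
    ((-1) ^+ ((p.-1 %/ 2) * (m %/ 2))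
       * (legendre m p)%:~R
       * (legendre 2 p)%:~R ^+ (m - 1)
       * qvar ^+ (2 * m * \sum_(1 <= k < (m %/ 2).+1) 'C((k * p) %/ m + 1, 2))
       * \prod_(1 <= k < (m %/ 2).+1)
           qbinom (qvar ^+ (2 * m)) p.-1 ((k * p) %/ m))
    (1 + m%:R * qint qvar p * qEulerStar p m qvar
       + (2 * (m %/ 2) + 1)%:R * qint (qvar ^+ m) p * qFermat p 2 (qvar ^+ m)
       - m%:R * qint qvar p * qFermat p 2 qvar
       + m%:R * (#|Rset p m| + 2 * \sum_(1 <= j < (p.-1 %/ 2).+1) ((j * m) %/ p))%:R
           * (1 - qvar ^+ p))
    (qint ('X : {poly rat}) p) 2.
Proof.
have p_odd := prime_ge5_odd p_prime p_ge5.
have m0 : (0 < m)%N by apply: ltnW.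
have q1 : 1 - qvar != 0 := @subr1_qvarX_neq0 1 isT.
have qint_neq0 a : (0 < a)%N -> qint (qvar ^+ a) p != 0.
  move=> a0; have : 1 - qvar ^+ (a * p) != 0.
    by apply: subr1_qvarX_neq0; rewrite muln_gt0 a0 prime_gt0.
  rewrite exprM.
  rewrite -(qint_geom (qvar ^+ a) p).
  by rewrite mulf_eq0 negb_or => /andP[].
have q1' : 1 + qvar != 0.
  have := @subr1_qvarX_neq0 2 isT; have -> : 1 - qvar ^+ 2 = (1 - qvar) * (1 + qvar) by ring.
  by rewrite mulf_eq0 negb_or => /andP[].
have EulerE := qEulerStarE p_ndvd_m q1 q1' (qint_neq0 2%N isT).
split=> //.
have FermatE a : (0 < a)%N -> qint (qvar ^+ a) p * qFermat p 2 (qvar ^+ a)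
    = qpoch ((qvar ^+ a) ^+ 2) ((qvar ^+ a) ^+ 2) p.-1
        / qpoch (qvar ^+ a) (qvar ^+ a) p.-1 - 1.
  by move=> a0; rewrite /qFermat mulrC divfK ?qint_neq0.
have := FermatE 1%N isT; rewrite expr1 => FermatE1.
(* Clearing the denominators [p]_q leaves the products themselves. *)
rewrite -[_ * qint qvar p * qEulerStar _ _ _]mulrA -[_ * qint qvar p * qFermat _ _ _]mulrA.
rewrite -[_ * qint (qvar ^+ m) p * _]mulrA FermatE // FermatE1.
rewrite EulerE [qint qvar p * (_ / _)]mulrC divfK ?(qint_neq0 1%N) //.
have ExpL := expands_qbinom_product p_prime p_odd p_ndvd_m m0.
have ExpE := expands_euler p_prime p_odd p_ndvd_m.
have Exp2 := expands_qpoch_double p_prime p_odd p_ndvd_m.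
have p_ndvd1 : ~~ (p %| 1)%N by rewrite dvdn1; case: (p) p_ge5 => [|[]].
have := expands_qpoch_double p_prime p_odd p_ndvd1; rewrite expr1 => Exp1.
have Bal := sum_inv_absres p_prime p_odd p_ndvd_m.
rewrite (expansions_balance (fun i => (1 - qvar ^+ (2 * m * i))^-1) (far p m)) in ExpL; last first.
  by move=> i /andP[_ Hi]; apply: floor_low.
rewrite (card_Rset m p_odd) -/(halfp p).
have a1E : \sum_(1 <= i < (halfp p).+1) - (1 / (1 - qvar ^+ (2 * 1 * i)))
    = - \sum_(1 <= i < (halfp p).+1) (1 - qvar ^+ (2 * i))^-1 :> ratfun.
  by rewrite sumrN; congr (- _); apply: eq_bigr => i _; rewrite div1r muln1.
rewrite a1E in Exp1.
exact: (eqmod_of_expansions p_prime ExpL ExpE Exp2 Exp1 Bal).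
Qed.
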